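(* Let $\mathscr{C}$ be a class of metric spaces and let $Z$ be a metrizable space. Assume that for each $(X,d)\in\mathscr{C}$ there exists a metric space $(Y,D)$ containing $X$ as a subspace with $D|_{X^2}=d$, and there exists a closed topological embedding from $Y\oplus\{pt\}$ to $Z$. Then $(\mathrm{Met}(Z),\mathcal{D}_Z)$ is universal for $\mathscr{C}$, and $(\mathrm{BMet}(Z),\mathcal{D}_Z)$ is universal for $\mathrm{B}(\mathscr{C})$.
   Context: For a metrizable space $Z$, $\mathrm{Met}(Z)$ is the set of all metrics on $Z$ that generate the given topology of $Z$, and $\mathrm{BMet}(Z)$ is the set of all bounded metrics in $\mathrm{Met}(Z)$. The sup-metric is $\mathcal{D}_Z(d,e)=\sup_{x,y\in Z}|d(x,y)-e(x,y)|$ (a priori possibly taking the value $\infty$); subsets carry its restriction. A space $(M,\rho)$ is universal for a class $\mathscr{C}$ of metric spaces if every member of $\mathscr{C}$ admits an isometric (distance-preserving) embedding into $(M,\rho)$. $\mathrm{B}(\mathscr{C})$ denotes the class of all bounded metric spaces belonging to $\mathscr{C}$. $\{pt\}$ is the one-point space and $\oplus$ denotes the topological sum. A closed topological embedding is a homeomorphism onto a closed subset. *)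

(* Defs.v *)
From mathcomp Require Import all_boot all_order all_algebra.
From mathcomp Require Import all_classical all_reals all_analysis.

Set Implicit Arguments.
Unset Strict Implicit.
Unset Printing Implicit Defensive.

Import Order.TTheory GRing.Theory Num.Theory.

Local Open Scope classical_set_scope.
Local Open Scope ring_scope.

(* Nonnegativity follows from the four axioms, as in the factory [isMetric]. *)
Definition is_metric (R : realType) (T : Type) (d : T -> T -> R) : Prop :=
  [/\ forall x, d x x = 0,
      forall x y, d x y = 0 -> x = y,
      forall x y, d x y = d y x &
      forall x y z, d x z <= d x y + d y z].

Definition generates_topology (R : realType) (Z : topologicalType)
    (d : Z -> Z -> R) : Prop :=
  forall U : set Z, open U <->
    (forall x, U x -> exists2 e : R, 0 < e & [set y | d x y < e] `<=` U).

Definition Met (R : realType) (Z : topologicalType) : set (Z -> Z -> R) :=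
  [set d | is_metric d /\ generates_topology d].

Arguments Met : clear implicits.

Definition bounded_dist (R : realType) (T : Type) (d : T -> T -> R) : Prop :=
  exists M : R, forall x y, d x y <= M.

Definition BMet (R : realType) (Z : topologicalType) : set (Z -> Z -> R) :=
  [set d | Met R Z d /\ bounded_dist d].

Arguments BMet : clear implicits.

Definition metrizable (R : realType) (Z : topologicalType) : Prop :=
  Met R Z !=set0.

(* Extended-real valued, since the supremum may be +oo. On the empty space it is
   the supremum of the empty set, -oo instead of the conventional 0. *)
Definition supmetric (R : realType) (Z : Type) (d e : Z -> Z -> R) : \bar R :=
  ereal_sup [set (`|d p.1 p.2 - e p.1 p.2|)%:E | p in [set: Z * Z]].

Definition isometric_embedding (R : realType) (X Y : metricType R)
    (f : X -> Y) : Prop :=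
  forall x y, mdist (f x) (f y) = mdist x y.

(* A class of metric spaces is a predicate on [metricType R]; the space whose
   universality is asserted is a subset [M] of [T], with the restriction to [M]
   of an extended-real valued distance [rho] on [T]. *)
Definition universal (R : realType) (T : Type) (M : set T)
    (rho : T -> T -> \bar R) (C : metricType R -> Prop) : Prop :=
  forall X : metricType R, C X ->
    exists2 f : X -> T, (forall x, M (f x)) &
      (forall x y, rho (f x) (f y) = (mdist x y)%:E).

Definition bounded_class (R : realType) (C : metricType R -> Prop)
    (X : metricType R) : Prop :=
  C X /\ bounded_dist (@mdist R X).

Definition add_point_fam (Y : topologicalType) (b : bool) : topologicalType :=
  if b then Y else discrete_topology unit.

(* The topological sum of Y and a one-point space, through the library's sum
   topology on sigma types. *)
Definition add_point (Y : topologicalType) : topologicalType :=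
  {b : bool & add_point_fam Y b}.

(* A set contained in [A] is open in [subspace A] iff it is relatively open in
   [A]; the third clause is thus the continuity of the inverse of [f], defined
   on the image of [f]. *)
Definition closed_embedding (S Z : topologicalType) (f : S -> Z) : Prop :=
  [/\ injective f,
      continuous f,
      forall U : set S, open U -> open (f @` U : set (subspace (range f))) &
      closed (range f)].

(* Main.v *)
Require Import Defs.
From mathcomp Require Import all_boot all_order all_algebra.
From mathcomp Require Import all_classical all_reals all_analysis.
From mathcomp Require Import ring lra.

(** Let [w] be a metric of [Z], let [e] be the embedding of [Y] and [p] the image
    of the added point.  First, [D] on the closed set [e(Y)] extends to a
    continuous pseudometric [q] on [Z].  Let [s : Z -> [0, 1]] be Lipschitz with
    [s p = 0] and [s = 1] on [e(Y)], and view [u : Z] as the point at height [s u]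
    of a cone over [(Z, q)] in which the vertical unit of length at [u] is
    [q a u].  The resulting pseudometric, plus [min w 1], is a metric [E_a] of
    [Z].  As [q a] depends nonexpansively on [a] and enters the formula with a
    single coefficient in [[0, 1]], the sup-distance of [E_a] and [E_b] is at most
    [q a b]; the pair [(a, p)] attains it.

    The extension [q] avoids partitions of unity.  Hausdorff's formula
    [inf_z (h z + w u (e z) / w u (e Y) - 1)] extends a nonnegative function [h]
    from [e(Y)] to [Z], and turns a pointwise bounded, equicontinuous family into
    an equicontinuous one; the supremum of the oscillations of such a family is a
    continuous pseudometric. *)

Set Implicit Arguments.
Unset Strict Implicit.
Unset Printing Implicit Defensive.

Import Order.TTheory GRing.Theory Num.Theory.

Local Open Scope classical_set_scope.
Local Open Scope ring_scope.

(** * Infima and suprema of families, pseudometrics *)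

Lemma inf_range_le (R : realType) (I : Type) (f : I -> R) (b : R) :
  (forall i, b <= f i) -> forall i, inf (range f) <= f i.
Proof.
move=> bf i; apply: ge_inf; last by exists i.
by exists b => _ [j _ <-].
Qed.

Lemma le_inf_range (R : realType) (I : Type) (f : I -> R) (b : R) :
  inhabited I -> (forall i, b <= f i) -> b <= inf (range f).
Proof.
by case=> i bf; apply: lb_le_inf => [|_ [j _ <-]//]; exists (f i), i.
Qed.

Definition pseudometric (R : realType) (T : Type) (d : T -> T -> R) : Prop :=
  [/\ forall x, d x x = 0,
      forall x y, d x y = d y x &
      forall x y z, d x z <= d x y + d y z].

Lemma pseudometric_ge0 (R : realType) (T : Type) (d : T -> T -> R) :
  pseudometric d -> forall x y, 0 <= d x y.
Proof.
move=> [d0 dC dT] x y; have := dT x y x; rewrite d0 (dC y x); lra.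
Qed.

Definition dist_continuous (R : realType) (T : Type) (w q : T -> T -> R) :=
  forall u (e : R), 0 < e ->
    exists2 del : R, 0 < del & forall v, w u v < del -> q u v < e.

(** The sup-norm distance pulled back along [u |-> (F c u)_c], in the manner of Kuratowski's
    embedding. *)
Definition sup_dist (R : realType) (I T : Type) (F : I -> T -> R) (u v : T) :=
  sup (range (fun c => `|F c u - F c v|)).

Lemma sup_dist_le (R : realType) (I T : Type) (F : I -> T -> R) u v (K : R) :
  inhabited I -> (forall c, `|F c u - F c v| <= K) -> sup_dist F u v <= K.
Proof.
by case=> i FK; apply: ge_sup => [|_ [j _ <-]//]; eexists; exists i.
Qed.

Definition pairwise_bounded (R : realType) (I T : Type) (F : I -> T -> R) :=
  forall u v, exists K : R, forall c, `|F c u - F c v| <= K.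

Lemma le_sup_dist (R : realType) (I T : Type) (F : I -> T -> R) c u v :
  pairwise_bounded F -> `|F c u - F c v| <= sup_dist F u v.
Proof.
move=> FK; have [K FuvK] := FK u v.
apply: ub_le_sup; last by exists c.
by exists K => _ [j _ <-].
Qed.

Lemma sup_dist_pseudometric (R : realType) (I T : Type) (F : I -> T -> R) :
  inhabited I -> pairwise_bounded F -> pseudometric (sup_dist F).
Proof.
move=> hI FK; split=> [x|x y|x y z].
- apply/eqP; rewrite eq_le; apply/andP; split.
    by apply: sup_dist_le => // c; rewrite subrr normr0.
  case: (hI) => i; apply: le_trans (le_sup_dist i _ _ FK) => //.
- by congr sup; apply: eq_imagel => c _; rewrite distrC.
- apply: sup_dist_le => // c; apply: le_trans (ler_distD (F c y) _ _) _.
  by apply: lerD; apply: le_sup_dist.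
Qed.

(** * Hausdorff's extension from a closed copy *)

(** A closed embedding in terms of [w] and [D]: the last two clauses express continuity of the
    inverse of [e] and closedness of the image. *)
Definition closed_copy (R : realType) (Y Z : Type) (w : Z -> Z -> R)
    (D : Y -> Y -> R) (e : Y -> Z) : Prop :=
  [/\ injective e,
      forall y (eps : R), 0 < eps ->
        exists2 del : R, 0 < del & forall z, w (e y) (e z) < del -> D y z < eps &
      forall u, ~ (exists z, e z = u) ->
        exists2 del : R, 0 < del & forall z, del <= w u (e z)].

Definition dist_to (R : realType) (Y Z : Type) (w : Z -> Z -> R) (e : Y -> Z)
    (u : Z) : R := inf (range (fun z => w u (e z))).

(** For [u] off a closed copy, the term added to [h z] is nonnegative, small when [e z] is almost
    nearest to [u], and large when [e z] is far away compared with the distance of [u] to the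
    copy. *)
Definition hausdorff_ext (R : realType) (Y Z : Type) (w : Z -> Z -> R)
    (e : Y -> Z) (h : Y -> R) (u : Z) : R :=
  if pselect (exists z, e z = u) is left uA then h (projT1 (cid uA))
  else inf (range (fun z => h z + (w u (e z) / dist_to w e u - 1))).

Section DistTo.
Context (R : realType) (Y Z : Type) (w : Z -> Z -> R) (D : Y -> Y -> R)
  (e : Y -> Z) (y0 : Y) (mw : pseudometric w) (mD : pseudometric D)
  (eA : closed_copy w D e).

Let w_ge0 := pseudometric_ge0 mw.

Lemma dist_to_le u z : dist_to w e u <= w u (e z).
Proof. exact: (inf_range_le (b := 0)). Qed.

Lemma dist_to_lip u v : dist_to w e u <= dist_to w e v + w u v.
Proof.
have [_ wC wT] := mw.
rewrite -lerBlDr; apply: le_inf_range => [|z]; first exact: (inhabits y0).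
by rewrite lerBlDr (le_trans (dist_to_le _ z))// addrC.
Qed.

Lemma dist_to_gt0 u : ~ (exists z, e z = u) -> 0 < dist_to w e u.
Proof.
have [_ _ eC] := eA => /eC[del del0 uA]; apply: lt_le_trans del0 _.
by apply: le_inf_range => //; exact: (inhabits y0).
Qed.

Lemma hausdorff_ext_on h z : hausdorff_ext w e h (e z) = h z.
Proof.
rewrite /hausdorff_ext; case: pselect => [zA|]; last by case; exists z.
by congr h; case: cid => /= z'; have [eI _ _] := eA => /eI.
Qed.

Lemma hausdorff_ext_le h u z : ~ (exists z, e z = u) -> (forall y, 0 <= h y) ->
  hausdorff_ext w e h u <= h z + (w u (e z) / dist_to w e u - 1).
Proof.
move=> uA h0; rewrite /hausdorff_ext; case: pselect => // _.
apply: (inf_range_le (b := 0)) => y.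
by rewrite addr_ge0// subr_ge0 ler_pdivlMr ?dist_to_gt0// mul1r dist_to_le.
Qed.

Lemma le_hausdorff_ext h u b : ~ (exists z, e z = u) ->
  (forall z, b <= h z + (w u (e z) / dist_to w e u - 1)) ->
  b <= hausdorff_ext w e h u.
Proof.
move=> uA hb; rewrite /hausdorff_ext; case: pselect => // _.
by apply: le_inf_range => //; exact: (inhabits y0).
Qed.

Lemma hausdorff_ext_ge0 h u : (forall y, 0 <= h y) -> 0 <= hausdorff_ext w e h u.
Proof.
move=> h0; have [[z <-]|uA] := pselect (exists z, e z = u).
  by rewrite hausdorff_ext_on.
apply: le_hausdorff_ext => // z.
by rewrite addr_ge0// subr_ge0 ler_pdivlMr ?dist_to_gt0// mul1r dist_to_le.
Qed.

(** Put [t = w u v / dist_to w e v]. From [u] to [v], a ratio [x] in the infimum grows to at most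
    [x * (1 + t) + t]. The shift by 2 turns the term at [u] into [h z + x + 1], whose 1 absorbs the
    additive [t]. *)
Lemma hausdorff_ext_off_lip h u v : (forall y, 0 <= h y) ->
  ~ (exists z, e z = u) -> ~ (exists z, e z = v) ->
  hausdorff_ext w e h v + 2 <=
    (hausdorff_ext w e h u + 2) * (1 + w u v / dist_to w e v).
Proof.
move=> h0 uA vA; have [_ wC wT] := mw.
have ru := dist_to_gt0 uA; have rv := dist_to_gt0 vA.
set k := 1 + _; have k0 : 0 < k by rewrite ltr_pwDl// divr_ge0// ltW.
rewrite -ler_pdivrMr// -lerBlDr; apply: le_hausdorff_ext => // z.
rewrite lerBlDr ler_pdivrMr//.
apply: le_trans (lerD (hausdorff_ext_le z vA h0) (lexx _)) _.
have wv : w v (e z) / dist_to w e v <=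
    (w u (e z) + w u v) / dist_to w e v.
  by rewrite ler_pM2r ?invr_gt0// (wC u v) addrC.
have wr : w u (e z) / dist_to w e v <= w u (e z) / dist_to w e u * k.
  rewrite /k -[X in _ <= _ * (X + _)](divff (lt0r_neq0 rv)) -mulrDl mulrA.
  rewrite ler_pM2r ?invr_gt0// mulrAC ler_pdivlMr// ler_wpM2l//.
  exact: dist_to_lip.
have gap : 0 <= w u (e z) / dist_to w e u by rewrite divr_ge0// ltW.
have t0 : 0 <= w u v / dist_to w e v by rewrite divr_ge0// ltW.
move: wv wr gap t0 (h0 z); rewrite /k mulrDl => wv wr gap t0 hz.
move: (mulr_ge0 hz t0); lra.
Qed.

(** * Equicontinuity of a family of extensions *)

Section Family.
Context (I : Type) (h : I -> Y -> R) (K : Y -> R)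
  (h0 : forall c y, 0 <= h c y) (hK : forall c y, h c y <= K y)
  (hD : forall c y z, `|h c y - h c z| <= 2 * D y z).

Lemma hausdorff_ext_bounded u : exists M, forall c, hausdorff_ext w e (h c) u <= M.
Proof.
have [[z <-]|uA] := pselect (exists z, e z = u).
  by exists (K z) => c; rewrite hausdorff_ext_on.
exists (K y0 + (w u (e y0) / dist_to w e u - 1)) => c.
by apply: le_trans (hausdorff_ext_le y0 uA (h0 c)) _; rewrite lerD2r.
Qed.

Lemma hausdorff_ext_equicontinuous_off u : ~ (exists z, e z = u) ->
  forall eps : R, 0 < eps -> exists2 del : R, 0 < del & forall v, w u v < del ->
    forall c, `|hausdorff_ext w e (h c) u - hausdorff_ext w e (h c) v| <= eps.
Proof.
move=> uA eps eps0; have [_ wC wT] := mw.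
have r0 := dist_to_gt0 uA; set r := dist_to w e u in r0.
have [M0 M0P] := hausdorff_ext_bounded u; pose M := `|M0| + 2.
have MP c : hausdorff_ext w e (h c) u + 2 <= M.
  by rewrite lerD2r (le_trans (M0P c))// ler_norm.
have M_gt0 : 0 < M by rewrite ltr_wpDl.
(* Within [k * r / 2] of [u] the distance to the copy is at least [r / 2], so the ratios in [t1] and
   [t2] are at most [k]. As [k <= 1], the value at [v] plus 2 is at most [2 * M], and the two values
   differ by at most [2 * (k * M)]. *)
pose k := Num.min 1 (eps / (2 * M)).
have k0 : 0 < k by rewrite lt_min ltr01 divr_gt0// mulr_gt0.
have k1 : k <= 1 by rewrite ge_min lexx.
have kM : 2 * (k * M) <= eps.
  by rewrite mulrCA -ler_pdivlMr ?mulr_gt0// ge_min lexx orbT.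
exists (k * r / 2); first by rewrite divr_gt0// mulr_gt0.
move=> v uv c; have rv : r / 2 <= dist_to w e v.
  have := dist_to_lip u v; rewrite -/r; nra.
have rv0 : 0 < dist_to w e v by apply: lt_le_trans rv; rewrite divr_gt0.
have vA : ~ (exists z, e z = v).
  case=> z zv; have := dist_to_le v z; rewrite zv.
  by have [w0 _ _] := mw; rewrite w0 leNgt rv0.
have t1 : w u v / dist_to w e v <= k.
  by rewrite ler_pdivrMr//; nra.
have t2 : w v u / dist_to w e u <= k.
  by rewrite ler_pdivrMr// wC -/r; nra.
have := hausdorff_ext_off_lip (h0 c) uA vA.
have := hausdorff_ext_off_lip (h0 c) vA uA.
have := MP c.
have := hausdorff_ext_ge0 u (h0 c); have := hausdorff_ext_ge0 v (h0 c).
set a := hausdorff_ext _ _ _ u; set b := hausdorff_ext _ _ _ v.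
set s := w u v / _ in t1 *; set t := w v u / _ in t2 *.
move=> b0 a0 aM ab ba.
have ab' : a + 2 <= (b + 2) * (1 + k) by apply: le_trans ab _; nra.
have ba' : b + 2 <= (a + 2) * (1 + k) by apply: le_trans ba _; nra.
have ak : (a + 2) * k <= M * k by rewrite ler_pM2r.
have bk : (b + 2) * k <= 2 * (M * k) by nra.
rewrite ler_norml; apply/andP; split; lra.
Qed.

Lemma hausdorff_ext_equicontinuous_on y :
  forall eps : R, 0 < eps -> exists2 del : R, 0 < del & forall v, w (e y) v < del ->
    forall c, `|hausdorff_ext w e (h c) (e y) - hausdorff_ext w e (h c) v| <= eps.
Proof.
move=> eps eps0; have [_ wC wT] := mw; have [eI eD eC] := eA.
have [|del0 del0_gt0 yD] := eD y (eps / 4); first by rewrite divr_gt0.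
have K0 : 0 <= `|K y| by [].
(* The 3 puts every [e z] with [w v (e z) < 2 * dist_to w e v] within [del0] of [e y]; the absolute
   value of [K y] makes the term added for any [z] outside that ball at least [h c y]. *)
pose k := `|K y| + 3.
exists (del0 / k); first by rewrite divr_gt0// ltr_wpDl.
move=> v yv c; rewrite hausdorff_ext_on.
have hK' : h c y <= `|K y| by apply: le_trans (hK c y) (ler_norm _).
have yvk : w (e y) v * k < del0 by rewrite -ltr_pdivlMr// ltr_wpDl.
have wyv := w_ge0 (e y) v.
have [[z zv]|vA] := pselect (exists z, e z = v).
  rewrite -zv hausdorff_ext_on (le_trans (hD c y z))//.
  have : D y z < eps / 4 by apply: yD; rewrite zv; move: yvk; rewrite /k; nra.
  lra.
have rv := dist_to_gt0 vA.
have ry : dist_to w e v <= w (e y) v by rewrite wC dist_to_le.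
have near z : w (e y) (e z) < del0 -> `|h c y - h c z| <= eps / 2.
  by move=> /yD yz; apply: le_trans (hD c y z) _; lra.
rewrite ler_norml; apply/andP; split; last first.
  rewrite lerBlDr -lerBlDl; apply: le_hausdorff_ext => // z.
  have gap : 0 <= w v (e z) / dist_to w e v - 1.
    by rewrite subr_ge0 ler_pdivlMr// mul1r dist_to_le.
  have [/near|far] := ltP (w (e y) (e z)) del0.
    by rewrite ler_norml => /andP[_]; lra.
  have : `|K y| + 1 <= w v (e z) / dist_to w e v.
    rewrite ler_pdivlMr//; have := wT (e y) v (e z).
    move: yvk; rewrite /k; nra.
  have := h0 c z; lra.
(* An almost nearest [z]: the bound [eps / 2] controls the added term, and the bound 1 keeps [e z]
   within [del0] of [e y]. *)
have [z zr] : exists z, w v (e z) < (1 + Num.min 1 (eps / 2)) * dist_to w e v.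
  have [| |_ [z _ <-] vz] := @inf_lt R (range (fun z => w v (e z)))
      ((1 + Num.min 1 (eps / 2)) * dist_to w e v).
  - by exists (w v (e y0)), y0.
  - rewrite -/(dist_to w e v) mulrDl mul1r ltrDl mulr_gt0//.
    by rewrite lt_min ltr01 divr_gt0.
  - by exists z.
have m1 : Num.min 1 (eps / 2) <= 1 by rewrite ge_min lexx.
have m2 : Num.min 1 (eps / 2) <= eps / 2 by rewrite ge_min lexx orbT.
have := hausdorff_ext_le z vA (h0 c).
have : w v (e z) / dist_to w e v <= 1 + eps / 2.
  by rewrite ler_pdivrMr// (le_trans (ltW zr))// ler_pM2r// lerD2l.
have /near : w (e y) (e z) < del0.
  have := wT (e y) v (e z); move: yvk; rewrite /k; nra.
by rewrite ler_norml => /andP[+ _]; lra.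
Qed.

Lemma hausdorff_ext_equicontinuous u :
  forall eps : R, 0 < eps -> exists2 del : R, 0 < del & forall v, w u v < del ->
    forall c, `|hausdorff_ext w e (h c) u - hausdorff_ext w e (h c) v| <= eps.
Proof.
have [[y <-]|uA] := pselect (exists z, e z = u).
  exact: hausdorff_ext_equicontinuous_on.
exact: hausdorff_ext_equicontinuous_off.
Qed.

End Family.

(* The functions [h c = D y0 c - D c _ + D y0 _] are nonnegative and, unlike
   [D c _], pointwise bounded; [h a] and [h b] together detect [D a b]. *)
Lemma dominating_pseudometric : exists C : Z -> Z -> R,
  [/\ pseudometric C, dist_continuous w C & forall a b, D a b <= C (e a) (e b)].
Proof.
have [D0 DC DT] := mD.
pose h c z := D y0 c - D c z + D y0 z.
have h_ge0 c z : 0 <= h c z.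
  by have := DT c y0 z; rewrite (DC c y0) /h; lra.
have h_le c z : h c z <= 2 * D y0 z.
  by have := DT y0 z c; rewrite (DC z c) /h; lra.
have h_lip c y z : `|h c y - h c z| <= 2 * D y z.
  rewrite ler_norml /h; apply/andP; split;
    have := DT c y z; have := DT c z y; have := DT y0 y z; have := DT y0 z y;
    rewrite (DC z y); lra.
pose F c := hausdorff_ext w e (h c).
have FB : pairwise_bounded F.
  move=> u v; have [Mu Mu_le] := hausdorff_ext_bounded h_ge0 h_le u.
  have [Mv Mv_le] := hausdorff_ext_bounded h_ge0 h_le v.
  exists (Mu + Mv) => c; rewrite ler_norml /F.
  have := Mu_le c; have := Mv_le c.
  have := hausdorff_ext_ge0 u (h_ge0 c); have := hausdorff_ext_ge0 v (h_ge0 c).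
  by move=> *; apply/andP; split; lra.
have hY : inhabited Y := inhabits y0.
exists (sup_dist F); split; first exact: sup_dist_pseudometric.
- move=> u eps eps0.
  have [|del del0 uP] :=
    hausdorff_ext_equicontinuous h_ge0 h_le h_lip u (eps := eps / 2).
    by rewrite divr_gt0.
  exists del => // v /uP uv; apply: (@le_lt_trans _ _ (eps / 2)); last by lra.
  exact: sup_dist_le.
(* The differences [h a a - h a b] and [h b b - h b a] add up to [2 * D a b], the terms in [y0]
   cancelling. *)
- move=> a b; have Fa := le_sup_dist a (e a) (e b) FB.
  have Fb := le_sup_dist b (e a) (e b) FB.
  move: Fa Fb; rewrite /F !hausdorff_ext_on /h !D0 (DC b a) !ler_norml.
  by move=> /andP[_ Fa] /andP[Fb _]; lra.
Qed.

(* McShane extensions of the functions [D y] with respect to a pseudometric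
   dominating [D]. *)
Lemma pseudometric_extension : exists q : Z -> Z -> R,
  [/\ pseudometric q, dist_continuous w q & forall a b, q (e a) (e b) = D a b].
Proof.
have [D0 DC DT] := mD; have D_ge0 := pseudometric_ge0 mD.
have [C [mC wC CD]] := dominating_pseudometric.
have [C0 CC CT] := mC; have C_ge0 := pseudometric_ge0 mC.
have hY : inhabited Y := inhabits y0.
pose g y u := inf (range (fun z => D y z + C (e z) u)).
have g_le y u z : g y u <= D y z + C (e z) u.
  by apply: (inf_range_le (b := 0)) => ?; rewrite addr_ge0.
have g_lip y u v : g y u <= g y v + C u v.
  rewrite -lerBlDr; apply: le_inf_range => // z.
  rewrite lerBlDr; apply: le_trans (g_le y u z) _.
  by have := CT (e z) v u; rewrite (CC v u); lra.
have gC y u v : `|g y u - g y v| <= C u v.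
  have := g_lip y u v; have := g_lip y v u; rewrite (CC v u) => *.
  by rewrite ler_norml; apply/andP; split; lra.
have g_e y a : g y (e a) = D y a.
  apply/eqP; rewrite eq_le; apply/andP; split.
    by apply: le_trans (g_le y (e a) a) _; rewrite C0 addr0.
  by apply: le_inf_range => // z; apply: le_trans (DT y z a) _; rewrite lerD2l.
have gB : pairwise_bounded g by move=> u v; exists (C u v).
(* On the copy [g y] is [D y], so [sup_dist g] restricts to the sup-distance in Kuratowski's
   embedding of [Y], which is [D]. Being at most [C], it is continuous. *)
exists (sup_dist g); split; first exact: sup_dist_pseudometric.
- move=> u eps /(wC u)[del del0 uP]; exists del => // v /uP.
  by apply: le_lt_trans; exact: sup_dist_le.
- move=> a b; apply/eqP; rewrite eq_le; apply/andP; split.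
    apply: sup_dist_le => // c; rewrite !g_e ler_norml.
    have := DT c a b; have := DT c b a; rewrite (DC b a) => *.
    by apply/andP; split; lra.
  apply: le_trans (le_sup_dist a _ _ gB).
  by rewrite !g_e D0 sub0r normrN ger0_norm.
Qed.

End DistTo.

(** * Cones over a pseudometric space *)

(** The length of a path from the higher point down to the level of the lower one and then across,
    horizontal lengths being scaled by the height. Level 0 is the apex. *)
Definition cone (R : realType) (T : Type) (s g : T -> R) (q : T -> T -> R)
    (u v : T) : R :=
  (if s v <= s u then (s u - s v) * g u else (s v - s u) * g v) +
  Num.min (s u) (s v) * q u v.

Section Cone.
Context (R : realType) (T : Type) (s g : T -> R) (q : T -> T -> R)
  (mq : pseudometric q) (s0 : forall u, 0 <= s u)
  (g_lip : forall u v, g u <= g v + q u v)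
  (q_le : forall u v, q u v <= g u + g v).

Lemma coneE u v : s v <= s u -> cone s g q u v = (s u - s v) * g u + s v * q u v.
Proof. by move=> vu; rewrite /cone vu min_r. Qed.

Lemma coneC u v : cone s g q u v = cone s g q v u.
Proof.
have [_ qC _] := mq; rewrite /cone minC qC.
by case: ltgtP => // ->; rewrite subrr !mul0r.
Qed.

(** With [s v <= s u], the defect of the triangle inequality is a nonnegative combination of the
    defect for [q] and of others depending on the level of [w]: those of [g_lip] and [0 <= g w]
    above both points, of [g_lip] between them, of [q_le] below both. *)
Lemma cone_pseudometric : pseudometric (cone s g q).
Proof.
have [q0 qC qT] := mq; have qq := pseudometric_ge0 mq.
have g0 u : 0 <= g u by have := q_le u u; rewrite q0; lra.
split; [by move=> x; rewrite coneE// subrr mul0r q0 mulr0 addr0|exact: coneC|].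
move=> u w v; wlog vu : u v / s v <= s u.
  move=> H; have [/H//|/ltW/H] := leP (s v) (s u).
  by rewrite coneC (coneC w u) (coneC v w) addrC.
rewrite (coneE vu); have := qT u w v; have := g_lip u w; have := q_le u v.
have := s0 u; have := s0 v; have := s0 w.
have [uw|/ltW wu] := leP (s u) (s w).
  rewrite coneC !coneE ?(le_trans vu)// (qC w u) => sw sv su quv guw qT'.
  have := mulr_ge0 sv (_ : 0 <= q u w + q w v - q u v).
  have := mulr_ge0 (_ : 0 <= s u - s v) (_ : 0 <= g w + q u w - g u).
  have := mulr_ge0 (_ : 0 <= s w - s u) (g0 w).
  rewrite !subr_ge0 => /(_ uw) h1 /(_ vu guw) h2 /(_ qT') h3; lra.
have [vw|/ltW wv] := leP (s v) (s w).
  rewrite !coneE// => sw sv su quv guw qT'.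
  have := mulr_ge0 sv (_ : 0 <= q u w + q w v - q u v).
  have := mulr_ge0 (_ : 0 <= s w - s v) (_ : 0 <= g w + q u w - g u).
  rewrite !subr_ge0 => /(_ vw guw) h2 /(_ qT') h3; lra.
rewrite coneE// coneC coneE// (qC v w) => sw sv su quv guw qT'.
have := mulr_ge0 sw (_ : 0 <= q u w + q w v - q u v).
have := mulr_ge0 (_ : 0 <= s v - s w) (_ : 0 <= g u + g v - q u v).
rewrite !subr_ge0 => /(_ wv quv) h2 /(_ qT') h3; lra.
Qed.

Lemma cone_le u v : (forall z, s z <= 1) ->
  cone s g q u v <= `|s u - s v| * (g u + q u v) + q u v.
Proof.
move=> s1; have [q0 qC _] := mq; have qq := pseudometric_ge0 mq u v.
rewrite /cone lerD//; last first.
  by rewrite ler_piMl// ge_min s1.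
case: (leP (s v) (s u)) => [vu|/ltW uv].
  rewrite ger0_norm ?subr_ge0// ler_wpM2l ?subr_ge0//; lra.
rewrite distrC ger0_norm ?subr_ge0// ler_wpM2l ?subr_ge0//.
by have := g_lip v u; rewrite (qC v u).
Qed.

End Cone.

Lemma cone_nonexpansive (R : realType) (T : Type) (s g g' : T -> R)
    (q : T -> T -> R) (K : R) :
  (forall u, 0 <= s u <= 1) -> (forall u, `|g u - g' u| <= K) ->
  forall u v, `|cone s g q u v - cone s g' q u v| <= K.
Proof.
move=> s01 gg' u v; rewrite /cone.
have /andP[su0 su1] := s01 u; have /andP[sv0 sv1] := s01 v.
rewrite opprD addrACA subrr addr0.
case: (leP (s v) (s u)) => [vu|/ltW uv]; rewrite -mulrBr normrM ger0_norm ?subr_ge0//.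
  by apply: le_trans (gg' u); rewrite ler_piMl//; lra.
by apply: le_trans (gg' v); rewrite ler_piMl//; lra.
Qed.

(** * Metrics of [Z] built from cones *)

Lemma is_metric_pseudometric (R : realType) (T : Type) (d : T -> T -> R) :
  is_metric d -> pseudometric d.
Proof. by case=> d0 _ dC dT; split. Qed.

Lemma dist_continuous_generates (R : realType) (Z : topologicalType)
    (w d : Z -> Z -> R) :
  generates_topology w -> dist_continuous w d -> dist_continuous d w ->
  generates_topology d.
Proof.
move=> wZ wd dw U; rewrite wZ; split=> UP x /UP[eps eps0 xU].
  have [del del0 xP] := dw x _ eps0; exists del => // y /= /xP; exact: xU.
have [del del0 xP] := wd x _ eps0; exists del => // y /= /xP; exact: xU.
Qed.

Lemma supmetricE (R : realType) (Z : Type) (d d' : Z -> Z -> R) (K : R) u v :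
  (forall x y, `|d x y - d' x y| <= K) -> `|d u v - d' u v| = K ->
  supmetric d d' = K%:E.
Proof.
move=> dK uvK; apply/eqP; rewrite eq_le; apply/andP; split.
  by apply: ge_ereal_sup => _ [[x y] _ <-]; rewrite lee_fin.
by apply: ereal_sup_ubound; exists (u, v) => //=; rewrite uvK.
Qed.

(** Used at [K = 1] for the summand [min w 1], and at a bound of the embedded space to make [q]
    bounded. *)
Lemma min_pseudometric (R : realType) (T : Type) (q : T -> T -> R) (K : R) :
  0 <= K -> pseudometric q -> pseudometric (fun u v => Num.min (q u v) K).
Proof.
move=> K0 mq; have [q0 qC qT] := mq; have qq := pseudometric_ge0 mq.
split=> [x|x y|x y z]; [by rewrite q0 min_l|by rewrite qC|].
have [xy|xy] := leP (q x y) K; have [yz|yz] := leP (q y z) K.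
- by rewrite ge_min qT.
- by rewrite ge_min lerDr qq orbT.
- by rewrite ge_min lerDl qq orbT.
- by rewrite ge_min lerDl K0 orbT.
Qed.

(** The first summand separates points and recovers the topology; being independent of [a], it
    cancels in differences. *)
Definition cone_metric (R : realType) (Z : Type) (w q : Z -> Z -> R)
    (s : Z -> R) (a : Z) (u v : Z) : R :=
  Num.min (w u v) 1 + cone s (q a) q u v.

Section ConeMetric.
Context (R : realType) (Z : topologicalType) (w q : Z -> Z -> R) (s : Z -> R)
  (wZ : Met R Z w) (mq : pseudometric q) (wq : dist_continuous w q)
  (s01 : forall u, 0 <= s u <= 1) (k : R) (s_lip : forall u v, `|s u - s v| <= k * w u v).

Let mw : pseudometric w.
Proof. by case: wZ => /is_metric_pseudometric. Qed.

Let s_ge0 u : 0 <= s u. Proof. by have /andP[] := s01 u. Qed.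

Let q_lip a u v : q a u <= q a v + q u v.
Proof. by have [_ qC qT] := mq; rewrite (qC u v). Qed.

Let q_le a u v : q u v <= q a u + q a v.
Proof. by have [_ qC qT] := mq; rewrite (qC a u). Qed.

Let cone_pm a := cone_pseudometric mq s_ge0 (q_lip a) (q_le a).

Lemma cone_dist_continuous a : dist_continuous w (cone s (q a) q).
Proof.
move=> u eps eps0; have qq := pseudometric_ge0 mq; have w0 := pseudometric_ge0 mw.
(* By [cone_le], once [q u v < 1] the vertical part is at most [(B - 1) * w u v]; the last 1 in [B]
   keeps it positive. *)
pose B := `|k| * (q a u + 1) + 1.
have B0 : 0 < B by rewrite ltr_wpDl// mulr_ge0// addr_ge0.
have [|d1 d10 uP] := wq u (e := Num.min 1 (eps / 2)).
  by rewrite lt_min ltr01 divr_gt0.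
exists (Num.min d1 (eps / (2 * B))).
  by rewrite lt_min d10 divr_gt0// mulr_gt0.
move=> v; rewrite lt_min => /andP[/uP]; rewrite lt_min => /andP[q1 q2].
rewrite ltr_pdivlMr ?mulr_gt0// => wB.
apply: le_lt_trans (cone_le mq (q_lip a) u v _) _.
  by move=> z; have /andP[] := s01 z.
have sk : `|s u - s v| <= `|k| * w u v.
  by apply: le_trans (s_lip u v) _; rewrite ler_wpM2r// ler_norm.
have : `|s u - s v| * (q a u + q u v) <= `|k| * w u v * (q a u + 1).
  by apply: ler_pM => //; [rewrite addr_ge0|rewrite lerD2l ltW].
rewrite mulrAC.
have := w0 u v; move: wB; rewrite /B; set A := `|k| * (q a u + 1); lra.
Qed.

Lemma cone_metric_Met a : Met R Z (cone_metric w q s a).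
Proof.
have [[w0 w_eq0 wC wT] gw] := wZ; have w_ge0 := pseudometric_ge0 mw.
have [m0 mC mT] := min_pseudometric ler01 mw.
have [c0 cC cT] := cone_pm a; have c_ge0 := pseudometric_ge0 (cone_pm a).
have min_le u v : Num.min (w u v) 1 <= cone_metric w q s a u v.
  by rewrite lerDl.
split.
  split=> [x|x y xy|x y|x y z].
  - by rewrite /cone_metric m0 c0 addr0.
  - apply: w_eq0; apply/eqP; rewrite eq_le w_ge0 andbT.
    by have := min_le x y; rewrite xy ge_min [1 <= 0]lt_geF ?orbF.
  - by rewrite /cone_metric mC cC.
  - by rewrite /cone_metric addrACA lerD.
apply: dist_continuous_generates gw _ _ => u eps eps0.
  have [|del del0 uP] := @cone_dist_continuous a u (eps / 2).
    by rewrite divr_gt0.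
  exists (Num.min del (eps / 2)); first by rewrite lt_min del0 divr_gt0.
  move=> v; rewrite lt_min => /andP[/uP cuv wuv].
  rewrite /cone_metric; have : Num.min (w u v) 1 <= w u v by rewrite ge_min lexx.
  lra.
(* A value below 1 of [min (w u v) 1] can only be [w u v] itself. *)
exists (Num.min eps 1); first by rewrite lt_min eps0 ltr01.
move=> v /(le_lt_trans (min_le u v)).
by rewrite lt_min !gt_min ltxx orbF => /andP[/orP[//|eps1] /lt_trans]; exact.
Qed.

Lemma cone_metric_bounded a (M : R) :
  (forall u v, q u v <= M) -> bounded_dist (cone_metric w q s a).
Proof.
(* The truncated [w] contributes 1, the vertical part [2 * M] and the horizontal part [M]. *)
move=> qM; exists (1 + 3 * M) => u v; rewrite /cone_metric.
have qq := pseudometric_ge0 mq; have M0 : 0 <= M := le_trans (qq u v) (qM u v).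
have := cone_le mq (q_lip a) u v (fun z => (andP (s01 z)).2).
have : Num.min (w u v) 1 <= 1 by rewrite ge_min lexx orbT.
have /andP[su0 su1] := s01 u; have /andP[sv0 sv1] := s01 v.
have : `|s u - s v| * (q a u + q u v) <= q a u + q u v.
  by rewrite ler_piMl ?addr_ge0// ler_norml; apply/andP; split; lra.
have := qM a u; have := qM u v; lra.
Qed.

Lemma supmetric_cone_metric a b p : s p = 0 -> s a = 1 ->
  supmetric (cone_metric w q s b) (cone_metric w q s a) = (q b a)%:E.
Proof.
move=> sp sa; have [q0 qC qT] := mq; have qq := pseudometric_ge0 mq.
apply: (@supmetricE _ _ _ _ _ a p) => [x y|].
  rewrite /cone_metric opprD addrACA subrr add0r.
  apply: cone_nonexpansive => // u; rewrite ler_norml.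
  have := qT b a u; have := qT a b u; rewrite (qC a b) => *.
  by apply/andP; split; lra.
(* From [a] at height 1 to the apex [p], the two cone distances are [q b a] and [q a a = 0]. *)
rewrite /cone_metric opprD addrACA subrr add0r !coneE ?sp ?sa//.
by rewrite !mul0r !addr0 subr0 !mul1r q0 subr0 ger0_norm.
Qed.

End ConeMetric.

(** Supplies the heights of the cone, with [p] at the apex and [A] at height 1. *)
Lemma separating_function (R : realType) (Z : Type) (w : Z -> Z -> R) (p : Z)
    (A : set Z) (r : R) :
  pseudometric w -> 0 < r -> (forall a, A a -> r <= w p a) ->
  exists s : Z -> R, [/\ forall u, 0 <= s u <= 1, s p = 0,
    forall a, A a -> s a = 1 & forall u v, `|s u - s v| <= r^-1 * w u v].
Proof.
move=> mw r0 pA; have [w0 wC wT] := mw; have w_ge0 := pseudometric_ge0 mw.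
exists (fun u => Num.min (w p u / r) 1); split.
- by move=> u; rewrite le_min ler01 divr_ge0 ?(ltW r0)//= ge_min lexx orbT.
- by rewrite w0 mul0r min_l.
- by move=> a /pA ra; rewrite min_r// ler_pdivlMr// mul1r.
- have lip u v : Num.min (w p u / r) 1 <= Num.min (w p v / r) 1 + r^-1 * w u v.
    have uv0 : 0 <= r^-1 * w u v by rewrite mulr_ge0// invr_ge0 ltW.
    have [v1|v1] := leP (w p v / r) 1; last by rewrite ge_min lerDl uv0 orbT.
    rewrite ge_min; apply/orP; left; rewrite (mulrC r^-1) -mulrDl.
    by rewrite ler_pM2r ?invr_gt0// (wC u v).
  move=> u v; have := lip u v; have := lip v u; rewrite (wC v u) => *.
  by rewrite ler_norml; apply/andP; split; lra.
Qed.

(** * From a closed embedding of the sum to data on [Z] *)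

Section AddPoint.
Context (R : realType) (Y : metricType R) (Z : topologicalType)
  (w : Z -> Z -> R) (wZ : Met R Z w) (i : add_point Y -> Z)
  (iP : closed_embedding i).

Let incl (y : Y) : add_point Y := existT (add_point_fam Y) true y.
Let pt : add_point Y := existT (add_point_fam Y) false tt.

Lemma add_point_case (x : add_point Y) : x = pt \/ exists y, x = incl y.
Proof. by case: x => -[] y; [right; exists y|left; case: y]. Qed.

Lemma closed_embedding_nbhs (U : set (add_point Y)) x : open U -> U x ->
  exists2 del : R, 0 < del & forall x', w (i x) (i x') < del -> U x'.
Proof.
move=> oU Ux; have [iI _ iO _] := iP; have [_ gw] := wZ.
have /open_subspaceP[V oV VU] := iO _ oU.
have /((gw V).1 oV)[del del0 xV] : V (i x).
  suff : (V `&` range i) (i x) by case.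
  by rewrite VU; split; exists x.
exists del => // x' /xV Vx'.
have [[x'' Ux'' /iI <-]//] : (i @` U `&` range i) (i x').
by rewrite -VU; split => //; exists x'.
Qed.

Lemma closed_copy_add_point : closed_copy w (@mdist R Y) (i \o incl).
Proof.
have [iI _ _ iC] := iP; have [_ gw] := wZ.
split=> [y z /iI|y eps eps0|u uA]; first exact: existT_inj2.
- have oU : open (incl @` (ball y eps)°).
    exact: (@existT_open_map _ (add_point_fam Y) true _ (open_interior _)).
  have [|del del0 yP] := closed_embedding_nbhs oU (x := incl y).
    by exists y => //; exact: nbhsx_ballx.
  exists del => // z /yP[z' z'y z'z].
  have <- : z' = z := existT_inj2 z'z.
  by have := interior_subset z'y; rewrite ballEmdist.
(* A point off the copy of [Y] is either off the closed range of [i] or the image of [pt], which is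
   isolated in the sum. *)
- have [[x _ xu]|uR] := pselect (range i u); last first.
    have /((gw _).1)/(_ _ uR)[del del0 uP] : open (~` range i).
      exact: closed_openC.
    exists del => // z; rewrite leNgt; apply/negP => /uP; apply.
    by exists (incl z).
  have xpt : x = pt.
    by have [//|[y xy]] := add_point_case x; case: uA; exists y; rewrite /= -xy.
  have oU : open ([set pt] : set (add_point Y)).
    have -> : [set pt] = existT (add_point_fam Y) false @` setT.
      by apply/seteqP; split=> [_ ->|_ [[] _ <-]//]; exists tt.
    exact/existT_open_map/openT.
  have [//|del del0 uP] := closed_embedding_nbhs oU (x := pt).
  exists del => // z; rewrite leNgt; apply/negP; rewrite -xu xpt.
  by move=> /uP.
Qed.

(** By injectivity the image of [pt] is off the copy of [Y], and that copy is closed. This point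
    becomes the apex. *)
Lemma point_copy_away (y0 : Y) : exists p, exists2 r : R, 0 < r &
  forall y, r <= w p (i (incl y)).
Proof.
have [iI _ _ _] := iP; have [_ _ away] := closed_copy_add_point.
have [|r r0 pr] := away (i pt); last by exists (i pt), r.
by case=> y /iI.
Qed.

(** The image of [X] in [Z] may fail to be closed, so the metric of the whole of [Y] is extended and
    only then restricted along [j]. *)
Lemma continuous_extension_data (X : metricType R) (j : X -> Y) (x0 : X) :
  isometric_embedding j ->
  exists (e : X -> Z) (q : Z -> Z -> R) (s : Z -> R) (p : Z) (k : R),
  [/\ pseudometric q /\ dist_continuous w q,
      forall u, 0 <= s u <= 1,
      forall u v, `|s u - s v| <= k * w u v,
      s p = 0 &
      forall x, s (e x) = 1 /\ forall y, q (e x) (e y) = mdist x y].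
Proof.
move=> jI; have mw : pseudometric w by have [/is_metric_pseudometric] := wZ.
have mD : pseudometric (@mdist R Y).
  by split; [exact: mdistxx|exact: metric_sym|exact: metric_triangle].
have [q [mq wq qD]] := pseudometric_extension (j x0) mw mD closed_copy_add_point.
have [p [r r0 pr]] := point_copy_away (j x0).
have [|s [s01 sp s1 s_lip]] :=
  @separating_function R Z w p (range (i \o incl)) r mw r0.
  by move=> _ [y _ <-]; exact: pr.
exists (i \o incl \o j), q, s, p, r^-1; split => // x.
split=> [|y]; first by apply: s1; exists (j x).
by rewrite -jI -qD.
Qed.

End AddPoint.

(** * Universality *)

Theorem theorem1p2 (R : realType) (C : metricType R -> Prop)
    (Z : topologicalType) (mZ : metrizable R Z)
    (hC : forall X : metricType R, C X ->
      exists Y : metricType R,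
        (exists j : X -> Y, isometric_embedding j) /\
        (exists i : add_point Y -> Z, closed_embedding i)) :
  universal (Met R Z) (@supmetric R Z) C /\
  universal (BMet R Z) (@supmetric R Z) (bounded_class C).
Proof.
have [w wZ] := mZ.
have data (X : metricType R) (x0 : X) : C X -> exists (e : X -> Z)
    (q : Z -> Z -> R) (s : Z -> R) (p : Z) (k : R),
    [/\ pseudometric q /\ dist_continuous w q,
      forall u, 0 <= s u <= 1,
      forall u v, `|s u - s v| <= k * w u v,
      s p = 0 &
      forall x, s (e x) = 1 /\ forall y, q (e x) (e y) = mdist x y].
  move=> /hC[Y [[j jI] [i iP]]].
  exact (continuous_extension_data wZ iP x0 jI).
split=> [X CX|X [CX [M XM]]].
  (* The extension is built from infima over the copy and needs a point; for empty [X] any map will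
     do. *)
  have [[x0]|X0] := pselect (inhabited X); last first.
    by exists (fun=> w) => x; case: X0; exists.
  have [e [q [s [p [k [[mq wq] s01 s_lip sp eP]]]]]] := data X x0 CX.
  exists (fun x => cone_metric w q s (e x)) => [x|x y].
    exact: cone_metric_Met s_lip _.
  by rewrite (supmetric_cone_metric _ mq s01 _ sp) ?(eP y).1// (eP x).2.
have [[x0]|X0] := pselect (inhabited X); last first.
  by exists (fun=> w) => x; case: X0; exists.
have [e [q [s [p [k [[mq wq] s01 s_lip sp eP]]]]]] := data X x0 CX.
have M0 : 0 <= M by apply: le_trans (XM x0 x0); rewrite mdistxx.
(* Since [Y] may be unbounded, [q] is truncated; distances in [X] are at most [M], so its values on
   the image of [X] are unchanged. *)
pose qM u v := Num.min (q u v) M.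
have mqM : pseudometric qM by exact: min_pseudometric.
have wqM : dist_continuous w qM.
  move=> u eps /(wq u)[del del0 uP]; exists del => // v /uP.
  by apply: le_lt_trans; rewrite ge_min lexx.
exists (fun x => cone_metric w qM s (e x)) => [x|x y].
  split; first exact: cone_metric_Met s_lip _.
  apply: (@cone_metric_bounded _ _ _ _ _ mqM s01 _ M) => u v.
  by rewrite ge_min lexx orbT.
rewrite (supmetric_cone_metric _ mqM s01 _ sp) ?(eP y).1//.
by rewrite /qM (eP x).2 min_l.
Qed.
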